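(* The problem of deciding whether a given instance of gGASP admits a core stable assignment, the problem of deciding whether it admits a Nash stable assignment, and the problem of deciding whether it admits an individually stable assignment are each in XP with respect to the number of players $n$.
   Context: An instance of the group activity selection problem with graph structure (gGASP) consists of: a finite set of players $N=\{1,\dots,n\}$; a finite set of activities $A=A^*\cup\{a_\emptyset\}$, where $A^*=\{a_1,\dots,a_p\}$ is the set of $p$ non-void activities and $a_\emptyset\notin A^*$ is the void activity; for each player $i$ a complete and transitive preference relation $\succeq_i$ on the set of alternatives $(A^*\times\{1,\dots,n\})\cup\{(a_\emptyset,1)\}$, with strict part $\succ_i$; and a set $L$ of edges making $(N,L)$ an undirected graph (arbitrary here). Two alternatives can be compared under $\succeq_i$ in unit time. An assignment is a map $\pi:N\to A$. For $a\in A^*$ let $\pi^a=\{i\in N:\pi(i)=a\}$; let $\pi_i=\{j\in N:\pi(j)=\pi(i)\}$ if $\pi(i)\ne a_\emptyset$, and $\pi_i=\{i\}$ if $\pi(i)=a_\emptyset$. A coalition $S\subseteq N$ is feasible if it is connected in $(N,L)$; $\pi$ is feasible if $\pi_i$ is feasible for every $i\in N$. Outcomes of gGASP are feasible assignments. $\pi$ is individually rational if $(\pi(i),|\pi_i|)\succeq_i(a_\emptyset,1)$ for every $i\in N$. A coalition $S\subseteq N$ and activity $a\in A^*$ strongly block $\pi$ if $\pi^a\subseteq S$ and $(a,|S|)\succ_i(\pi(i),|\pi_i|)$ for all $i\in S$. A core stable assignment is a feasible assignment that is individually rational and for which there is no nonempty connected coalition $S$ and activity $a\in A^*$ that strongly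 block it. Given a feasible assignment $\pi$, player $i$ has a feasible NS-deviation to $a\in A^*$ with $a\neq\pi(i)$ if $\pi^a\cup\{i\}$ is connected in $(N,L)$ and $(a,|\pi^a|+1)\succ_i(\pi(i),|\pi_i|)$. It is a feasible IS-deviation if, in addition, $(a,|\pi^a|+1)\succeq_j(a,|\pi^a|)$ for all $j\in\pi^a$. A Nash stable (respectively, individually stable) assignment is a feasible assignment that is individually rational and in which no player has a feasible NS-deviation (respectively, feasible IS-deviation). A problem is in XP (slice-wise polynomial) with respect to a parameter $k$ if each instance $I$ can be solved in time $|I|^{f(k)}$ for some computable function $f$. *)

(* Defs.v *)
From mathcomp Require Import all_boot.

Set Implicit Arguments.
Unset Strict Implicit.
Unset Printing Implicit Defensive.

(* Random access machines, with structured control flow.  A machine has       *)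
(* registers and an indirectly addressed memory, both holding naturals.  All  *)
(* instructions and tests take unit time; as the arithmetic is limited to     *)
(* addition and truncated subtraction, time on these machines is polynomially *)
(* equivalent to time on Turing machines.  Query asks a Boolean oracle, which *)
(* models data that can be inspected in unit time.                            *)

Inductive prog :=
  | Skip
  | Const (x c : nat)            (* r_x := c *)
  | Add (x y z : nat)            (* r_x := r_y + r_z *)
  | Sub (x y z : nat)            (* r_x := r_y - r_z *)
  | Read (x y : nat)             (* r_x := mem[r_y] *)
  | Write (x y : nat)            (* mem[r_x] := r_y *)
  | Query (x : nat) (ys : seq nat) (* r_x := oracle [:: r_y | y <- ys] *)
  | Seq (c1 c2 : prog)
  | If (x : nat) (c1 c2 : prog)  (* if r_x != 0 then c1 else c2 *)
  | While (x : nat) (c : prog).  (* while r_x != 0 do c *)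

Record state := State { regs : nat -> nat; mem : nat -> nat }.

Definition set_reg (s : state) (x v : nat) : state :=
  State [eta regs s with x |-> v] (mem s).

Definition set_mem (s : state) (a v : nat) : state :=
  State (regs s) [eta mem s with a |-> v].

(* exec o c s t s' : with oracle o, program c started in s halts in s' after  *)
(* exactly t steps.                                                           *)
Inductive exec (o : seq nat -> bool) : prog -> state -> nat -> state -> Prop :=
  | ExecSkip s : exec o Skip s 1 s
  | ExecConst s x c : exec o (Const x c) s 1 (set_reg s x c)
  | ExecAdd s x y z :
      exec o (Add x y z) s 1 (set_reg s x (regs s y + regs s z))
  | ExecSub s x y z :
      exec o (Sub x y z) s 1 (set_reg s x (regs s y - regs s z))
  | ExecRead s x y : exec o (Read x y) s 1 (set_reg s x (mem s (regs s y)))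
  | ExecWrite s x y : exec o (Write x y) s 1 (set_mem s (regs s x) (regs s y))
  | ExecQuery s x ys :
      exec o (Query x ys) s 1 (set_reg s x (o [seq regs s y | y <- ys]))
  | ExecSeq c1 c2 s1 s2 s3 t1 t2 :
      exec o c1 s1 t1 s2 -> exec o c2 s2 t2 s3 ->
      exec o (Seq c1 c2) s1 (t1 + t2) s3
  | ExecIfTrue x c1 c2 s s' t :
      regs s x != 0 -> exec o c1 s t s' -> exec o (If x c1 c2) s t.+1 s'
  | ExecIfFalse x c1 c2 s s' t :
      regs s x = 0 -> exec o c2 s t s' -> exec o (If x c1 c2) s t.+1 s'
  | ExecWhileTrue x c s1 s2 s3 t1 t2 :
      regs s1 x != 0 -> exec o c s1 t1 s2 -> exec o (While x c) s2 t2 s3 ->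
      exec o (While x c) s1 (t1 + t2).+1 s3
  | ExecWhileFalse x c s : regs s x = 0 -> exec o (While x c) s 1 s.

(* The input word is stored from address 0 on, its length in register 0.      *)
(* The output is read off register 0.                                         *)
Definition init (w : seq bool) : state :=
  State (fun x => if x == 0 then size w else 0) (fun a => nth false w a).

Definition computable (f : nat -> nat) : Prop :=
  exists c : prog, forall k : nat, exists (t : nat) (s : state),
    exec (fun=> false) c (init (nseq k true)) t s /\ regs s 0 = f k.

(* The problem "does Q hold of x?" is in XP with respect to par, where x is   *)
(* given by the word enc x (so |x| = size (enc x)), together with the         *)
(* unit-time oracle orc x.                                                    *)
Definition in_XP (T : Type) (enc : T -> seq bool) (orc : T -> seq nat -> bool)
    (par : T -> nat) (Q : T -> Prop) : Prop :=
  exists (c : prog) (f : nat -> nat), computable f /\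
    forall x : T, exists (t : nat) (s : state),
      [/\ exec (orc x) c (init (enc x)) t s,
          t <= size (enc x) ^ f (par x) &
          (Q x /\ regs s 0 = 1) \/ (~ Q x /\ regs s 0 = 0)].

(* Players are 'I_n and activities option 'I_p, None being the void activity. *)
(* In an alternative (a, k), k is the actual size, between 1 and n.           *)
Definition alternatives (n p : nat) : seq (option 'I_p * nat) :=
  (None, 1) :: [seq (Some a, k) | a <- enum 'I_p, k <- iota 1 n].

(* Preferences are only constrained, and only ever used, on alternatives.     *)
Record gGASP := GGASP {
  nplayers : nat;
  nactivities : nat;
  pref : 'I_nplayers -> rel (option 'I_nactivities * nat);
  edge : rel 'I_nplayers;
  pref_total : forall i,
    {in alternatives nplayers nactivities &, total (pref i)};
  pref_trans : forall i,
    {in alternatives nplayers nactivities & &, transitive (pref i)};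
  edge_sym : symmetric edge;
  edge_irr : irreflexive edge }.

Definition player (I : gGASP) := 'I_(nplayers I).
Definition activity (I : gGASP) := option 'I_(nactivities I).
Definition assignment (I : gGASP) := {ffun player I -> activity I}.

Definition sprefers (I : gGASP) (i : player I) (x y : activity I * nat) : bool :=
  pref i x y && ~~ pref i y x.

Definition connected (I : gGASP) (S : {set player I}) : bool :=
  [forall i in S, forall j in S,
     connect [rel u v | [&& u \in S, v \in S & edge u v]] i j].

Section Stability.

Variables (I : gGASP) (pi : assignment I).

Definition members (a : 'I_(nactivities I)) : {set player I} :=
  [set j | pi j == Some a].

Definition group (i : player I) : {set player I} :=
  if pi i is Some a then members a else [set i].

Definition feasible : Prop := forall i, connected (group i).

Definition outcome (i : player I) : activity I * nat := (pi i, #|group i|).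

Definition individually_rational : Prop :=
  forall i, pref i (outcome i) (None, 1).

Definition strongly_blocks (S : {set player I}) (a : 'I_(nactivities I)) : Prop :=
  members a \subset S /\
  (forall i, i \in S -> sprefers i (Some a, #|S|) (outcome i)).

Definition core_stable : Prop :=
  [/\ feasible, individually_rational &
      ~ exists (S : {set player I}) (a : 'I_(nactivities I)),
          [/\ S != set0, connected S & strongly_blocks S a]].

Definition NS_deviation (i : player I) (a : 'I_(nactivities I)) : Prop :=
  [/\ pi i <> Some a, connected (i |: members a) &
      sprefers i (Some a, #|members a|.+1) (outcome i)].

Definition IS_deviation (i : player I) (a : 'I_(nactivities I)) : Prop :=
  NS_deviation i a /\
  (forall j, j \in members a ->
     pref j (Some a, #|members a|.+1) (Some a, #|members a|)).

Definition Nash_stable : Prop :=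
  [/\ feasible, individually_rational & ~ exists i a, NS_deviation i a].

Definition individually_stable : Prop :=
  [/\ feasible, individually_rational & ~ exists i a, IS_deviation i a].

End Stability.

(* The word contains n and p in unary, the adjacency matrix of the graph, and *)
(* the table of the preference relation of every player.                      *)
Definition encode (I : gGASP) : seq bool :=
  let n := nplayers I in let p := nactivities I in
  nseq n true ++ false :: nseq p true ++ false ::
  [seq edge i j | i <- enum 'I_n, j <- enum 'I_n] ++
  flatten [seq [seq pref i x y | x <- alternatives n p, y <- alternatives n p]
          | i <- enum 'I_n].

Definition activity_code (p : nat) (a : option 'I_p) : nat :=
  if a is Some j then j.+1 else 0.

(* Unit-time comparison of alternatives: the query i, a, k, b, l asks whether *)
(* player i weakly prefers (a, k) to (b, l).  Ill-formed queries are rejected. *)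
Definition compare_alternatives (I : gGASP) (q : seq nat) : bool :=
  if q is [:: i; a; k; b; l] then
    [exists i' : player I, exists x : activity I, exists y : activity I,
      [&& i' == i :> nat, activity_code x == a, activity_code y == b,
          (x, k) \in alternatives (nplayers I) (nactivities I),
          (y, l) \in alternatives (nplayers I) (nactivities I) &
          pref i' (x, k) (y, l)]]
  else false.

Definition XP_in_players (Q : gGASP -> Prop) : Prop :=
  in_XP encode compare_alternatives nplayers Q.

(* Main.v *)
Require Import Defs.
From mathcomp Require Import all_boot.
From mathcomp Require Import zify.

(** Brute force: the (p+1)^n assignments are tried one after the other, and each
    is tested by quantifying over players, activities and the 2^n coalitions.
    Assignments and coalitions are coded as the digits of numbers in base p+1
    and 2, so that the whole test is a formula on naturals with bounded
    quantifiers.  The functions computable by our machines in time polynomial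
    in (n+p+2)^(n+1) and the values of their variables contain the arithmetic
    operations, the input word and the oracle, and are closed under iteration
    with bounded results; hence they contain that formula.  Since n+p+2 is at
    most the input size, the running time is |I|^O(n). *)

Set Implicit Arguments.
Unset Strict Implicit.
Unset Printing Implicit Defensive.

(** * Functions computable in bounded time *)

(** One fixed program must serve all instances, on machines that are awkward to compose and lack
    multiplication. Exact running times are therefore avoided: the calculus below only records that
    some power of the scale, fixed before the instance, bounds the time. Values must be bounded as
    well, since the value of a term may become the length of a loop or a variable of another term.
    The scale (n+p+2)^(n+1) dominates both (p+1)^n and 2^n, so the two exponential searches count as
    polynomially long loops. Connectedness through cuts costs only one more quantifier over subsets
    and avoids a graph search. Preferences come from the oracle, edges from the input word at an
    address computed from n and p. *)

(* A point of [env k] is an instance together with k numbers; the most recent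
   one comes first in [vars]. *)
Fixpoint env (k : nat) : Type := if k is j.+1 then (env j * nat)%type else gGASP.

Fixpoint inst (k : nat) : env k -> gGASP :=
  if k is j.+1 then fun e => inst e.1 else id.

Fixpoint vars (k : nat) : env k -> seq nat :=
  if k is j.+1 then fun e => e.2 :: vars e.1
  else fun I : gGASP => [:: nplayers I; nactivities I].

(* An upper bound for the numbers of assignments and of coalitions. *)
Definition scale0 (I : gGASP) : nat :=
  (nplayers I + nactivities I + 2) ^ (nplayers I).+1.

(** The sum lets a subterm under a binder take time depending on the bound variables. Dropping a
    variable never increases the scale, so bounds survive weakening. *)
Definition scale k (e : env k) : nat := scale0 (inst e) + sumn (vars e).

Lemma size_vars k (e : env k) : size (vars e) = k + 2.
Proof. by elim: k e => //= k IH e; rewrite IH. Qed.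

Lemma nth_vars_nplayers k (e : env k) : nth 0 (vars e) k = nplayers (inst e).
Proof. by elim: k e => //= k IH e; rewrite IH. Qed.

Lemma nth_vars_nactivities k (e : env k) :
  nth 0 (vars e) k.+1 = nactivities (inst e).
Proof. by elim: k e => //= k IH e; rewrite -IH. Qed.

(** The exponent n+1, rather than n, makes this true even without players. A base above 1 lets
    powers of the scale absorb constants and sums. *)
Lemma scale0_gt1 I : 1 < scale0 I.
Proof.
apply: (@leq_trans ((nplayers I + nactivities I + 2) ^ 1)).
  by rewrite expn1 addn2.
by rewrite leq_exp2l // addn2.
Qed.

Lemma scale_gt1 k (e : env k) : 1 < scale e.
Proof. exact: leq_trans (scale0_gt1 _) (leq_addr _ _). Qed.

(** * Polynomial bounds in the scale *)

Definition poly_bounded k (F : env k -> nat) : Prop :=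
  exists m, forall e, F e <= scale e ^ m.

Section PolyBounded.
Variable k : nat.
Implicit Types F G : env k -> nat.

Lemma poly_bounded_le F G :
  (forall e, F e <= G e) -> poly_bounded G -> poly_bounded F.
Proof. by move=> FG [m Gm]; exists m => e; apply: leq_trans (FG e) (Gm e). Qed.

Lemma poly_bounded_const c : poly_bounded (fun _ : env k => c).
Proof.
exists c => e; apply: leq_trans (ltnW (ltn_expl c (ltnSn 1))) _.
by case: c => // c; rewrite leq_exp2r // scale_gt1.
Qed.

Lemma poly_bounded_scale : poly_bounded (@scale k).
Proof. by exists 1 => e. Qed.

Lemma poly_bounded_mul F G :
  poly_bounded F -> poly_bounded G -> poly_bounded (fun e => F e * G e).
Proof. by move=> [a Fa] [b Gb]; exists (a + b) => e; rewrite expnD leq_mul. Qed.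

Lemma poly_bounded_add F G :
  poly_bounded F -> poly_bounded G -> poly_bounded (fun e => F e + G e).
Proof.
(* The extra factor [scale e], at least 2, pays for adding two terms that are each at most
   [scale e ^ (a + b)]. *)
move=> [a Fa] [b Gb]; exists (1 + (a + b)) => e.
have s1 := scale_gt1 e; rewrite expnD expn1.
apply: leq_trans (leq_mul s1 (leqnn _)); rewrite mul2n -addnn.
apply: leq_add; [apply: leq_trans (Fa e) _|apply: leq_trans (Gb e) _].
  by rewrite leq_exp2l // leq_addr.
by rewrite leq_exp2l // leq_addl.
Qed.

Lemma poly_bounded_exp F m : poly_bounded F -> poly_bounded (fun e => F e ^ m).
Proof.
move=> [a Fa]; exists (a * m) => e; rewrite expnM.
by case: m => // m; rewrite leq_exp2r.
Qed.

End PolyBounded.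

(** [r] lists the registers of the variables, in the order of [vars]. The memory must still be the
    input word, so that it can be consulted at any point. *)
Definition holds k (r : seq nat) (e : env k) (s : state) : Prop :=
  [seq regs s j | j <- r] = vars e /\ Defs.mem s = Defs.mem (init (encode (inst e))).

(* Registers below d hold the variables and the intermediate results that are
   still needed, so c may only change registers from d on. *)
Definition runs k (c : prog) (r : seq nat) (d : nat) (Fs : seq (env k -> nat))
    (T : env k -> nat) : Prop :=
  forall e s, holds r e s -> exists t s',
    [/\ exec (compare_alternatives (inst e)) c s t s', t <= T e,
        [seq regs s' j | j <- iota d (size Fs)] = [seq F e | F <- Fs],
        forall j, j < d -> regs s' j = regs s j & Defs.mem s' = Defs.mem s].

(** Quantifying over [r] and [d] makes a term compilable under any register layout and at any height
    of the evaluation stack. *)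
Definition computes k (F : env k -> nat) : Prop :=
  poly_bounded F /\ forall r d, all (ltn^~ d) r ->
    exists c T, poly_bounded T /\ runs c r d [:: F] T.

Definition decides k (P : env k -> bool) : Prop :=
  computes (fun e => P e : nat).

Lemma holds_eq k r d (e : env k) s s' :
  all (ltn^~ d) r -> (forall j, j < d -> regs s' j = regs s j) ->
  Defs.mem s' = Defs.mem s -> holds r e s -> holds r e s'.
Proof.
move=> /allP rd Es Em [Hr Hm]; split; last by rewrite Em.
by rewrite -Hr; apply/eq_in_map => j /rd /Es.
Qed.

Lemma all_ltn_weak r d d' : d <= d' -> all (ltn^~ d) r -> all (ltn^~ d') r.
Proof. by move=> le; apply: sub_all => j /leq_trans; apply. Qed.

Fixpoint all_computes k (Fs : seq (env k -> nat)) : Prop :=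
  if Fs is F :: Gs then computes F /\ all_computes Gs else True.

(** Stack evaluation: each argument is left in the next register, and the programs after it work
    strictly above, so the results stay available. *)
Lemma runs_seq k (Fs : seq (env k -> nat)) r d :
  all_computes Fs -> all (ltn^~ d) r ->
  exists c T, poly_bounded T /\ runs c r d Fs T.
Proof.
elim: Fs d => [|F Fs IH] d /=.
  move=> _ _; exists Skip, (fun=> 1); split; first exact: poly_bounded_const.
  by move=> e s _; exists 1, s; split=> //; apply: ExecSkip.
move=> [[_ /(_ r d) HF] /IH{}IH] rd.
have [c [T [HT Hc]]] := HF rd.
have rd1 := all_ltn_weak (leqnSn d) rd.
have [c' [T' [HT' Hc']]] := IH _ rd1.
exists (Seq c c'), (fun e => T e + T' e); split; first exact: poly_bounded_add.
move=> e s H; have [t [s1 [X tT [R1] P M]]] := Hc e s H.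
have H1 := holds_eq rd P M H.
have [t' [s' [X' tT' R' P' M']]] := Hc' e s1 H1.
exists (t + t'), s'; split=> //.
- exact: ExecSeq X X'.
- exact: leq_add.
- by rewrite /= P' // R1 R'.
- by move=> j jd; rewrite P' ?P // ltnW.
- by rewrite M'.
Qed.

Lemma computes_instr k (Fs : seq (env k -> nat)) (F : env k -> nat)
    (ins : nat -> prog) :
  poly_bounded F -> all_computes Fs ->
  (forall d e s, Defs.mem s = Defs.mem (init (encode (inst e))) ->
     [seq regs s j | j <- iota d (size Fs)] = [seq G e | G <- Fs] ->
     exec (compare_alternatives (inst e)) (ins d) s 1 (set_reg s d (F e))) ->
  computes F.
Proof.
move=> BF HFs Hins; split=> // r d rd.
have [c [T [HT Hc]]] := runs_seq HFs rd.
exists (Seq c (ins d)), (fun e => T e + 1); split.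
  by apply: poly_bounded_add => //; apply: poly_bounded_const.
move=> e s H; have [t [s1 [X tT R P M]]] := Hc e s H.
exists (t + 1), (set_reg s1 d (F e)); split=> //=.
- by apply: ExecSeq X _; apply: Hins => //; rewrite M; case: H.
- by rewrite leq_add2r.
- by rewrite eqxx.
- by move=> j jd; rewrite ltn_eqF // P.
Qed.

(** * Primitive operations *)

Section Basic.
Variable k : nat.
Implicit Types F G : env k -> nat.

Lemma computes_ext F G : F =1 G -> computes F -> computes G.
Proof.
move=> FG [[m BF] HF]; split; first by exists m => e; rewrite -FG.
move=> r d /HF [c [T [HT Hc]]]; exists c, T; split=> // e s /Hc [t [s' [? ? R ? ?]]].
by exists t, s'; split=> //; rewrite R /= FG.
Qed.

Lemma computes_const c : computes (fun _ : env k => c).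
Proof.
apply: (@computes_instr k [::] _ (fun d => Const d c)) => //.
  exact: poly_bounded_const.
by move=> d e s _ _; apply: ExecConst.
Qed.

Lemma computes_nth_vars j : j < k + 2 -> computes (fun e : env k => nth 0 (vars e) j).
Proof.
move=> jk; split.
  apply: (poly_bounded_le _ (@poly_bounded_scale k)) => e.
  apply: leq_trans (leq_addl _ _).
  have := size_vars e; move: (vars e) => v sv.
  rewrite -{}sv in jk; elim: v j jk => //= a v IH [|j]; rewrite /= ?leq_addr //.
  by move=> /IH /leq_trans; apply; apply: leq_addl.
(* No instruction copies registers: the variable is added to a fresh zero. *)
move=> r d rd; exists (Seq (Const d 0) (Add d (nth 0 r j) d)), (fun=> 2).
split; first exact: poly_bounded_const.
move=> e s [R M]; have jr : j < size r.
  by rewrite -(size_map (regs s)) R size_vars.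
pose s0 := set_reg s d 0.
exists (1 + 1), (set_reg s0 d (regs s0 (nth 0 r j) + regs s0 d)); split=> //.
- by apply: ExecSeq; [apply: ExecConst|apply: ExecAdd].
- have /(allP rd) jd := mem_nth 0 jr.
  by rewrite /= !eqxx ltn_eqF // addn0 -R (nth_map 0).
- by move=> i id /=; rewrite !ltn_eqF.
Qed.

Lemma computes_add F G : computes F -> computes G -> computes (fun e => F e + G e).
Proof.
move=> HF HG; apply: (@computes_instr k [:: F; G] _ (fun d => Add d d d.+1)) => //.
  by case: HF HG => ? _ [? _]; apply: poly_bounded_add.
by move=> d e s _ [<- <-]; apply: ExecAdd.
Qed.

Lemma computes_sub F G : computes F -> computes G -> computes (fun e => F e - G e).
Proof.
move=> HF HG; apply: (@computes_instr k [:: F; G] _ (fun d => Defs.Sub d d d.+1)) => //.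
  by case: HF => ? _; apply: (poly_bounded_le (G := F)) => // e; apply: leq_subr.
by move=> d e s _ [<- <-]; apply: ExecSub.
Qed.

Lemma decides_read F :
  computes F -> decides (fun e => nth false (encode (inst e)) (F e)).
Proof.
move=> HF; apply: (@computes_instr k [:: F] _ (fun d => Read d d)) => //.
  apply: (poly_bounded_le (G := fun=> 1)); last exact: poly_bounded_const.
  by move=> e; case: nth.
move=> d e s M [<-].
have -> : nth false (encode (inst e)) (regs s d) = Defs.mem s (regs s d) :> nat.
  by rewrite M.
exact: ExecRead.
Qed.

Lemma decides_compare F1 F2 F3 F4 F5 :
  computes F1 -> computes F2 -> computes F3 -> computes F4 -> computes F5 ->
  decides (fun e => compare_alternatives (inst e) [:: F1 e; F2 e; F3 e; F4 e; F5 e]).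
Proof.
move=> H1 H2 H3 H4 H5.
apply: (@computes_instr k [:: F1; F2; F3; F4; F5] _
  (fun d => Query d (iota d 5))) => //.
  apply: (poly_bounded_le (G := fun=> 1)); last exact: poly_bounded_const.
  by move=> e; case: compare_alternatives.
move=> d e s _ E.
by have := ExecQuery (compare_alternatives (inst e)) s d (iota d 5); rewrite E.
Qed.

End Basic.

(** No new code is needed: [hr] rearranges the register list given to the compiled term. The scale
    of [h e] is at most that of [e], so all bounds carry over. *)
Lemma computes_rename k l (h : env l -> env k) (hr : seq nat -> seq nat)
    (F : env k -> nat) :
  (forall r, {subset hr r <= r}) -> (forall e, inst (h e) = inst e) ->
  (forall e, scale (h e) <= scale e) ->
  (forall r e s, holds r e s -> holds (hr r) (h e) s) ->
  computes F -> computes (fun e => F (h e)).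
Proof.
move=> hr_sub h_inst h_scale h_holds [BF HF].
have B (G : env k -> nat) : poly_bounded G -> poly_bounded (fun e => G (h e)).
  move=> [m Gm]; exists m => e; apply: leq_trans (Gm _) _.
  by case: m {Gm} => // m; rewrite leq_exp2r.
split=> [|r d rd]; first exact: B.
have rd' : all (ltn^~ d) (hr r) by apply/allP => j /hr_sub /(allP rd).
have [c [T [HT Hc]]] := HF _ _ rd'; exists c, (fun e => T (h e)).
by split=> [|e s /h_holds /Hc]; [apply: B|rewrite h_inst].
Qed.

Lemma computes_weaken k (F : env k -> nat) :
  computes F -> computes (fun e : env k.+1 => F e.1).
Proof.
apply: (@computes_rename k k.+1 fst behead) => //.
- by move=> r j; apply: mem_behead.
- by move=> [e i]; rewrite /scale /= leq_add2l leq_addl.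
- by move=> [|a r] [e i] s [//= [_ R] M].
Qed.

(** Inserts a variable just below the newest one, so that a predicate on a bound index can be moved
    under an additional quantifier. *)
Lemma computes_weaken_under k (G : env k -> nat -> nat) :
  computes (fun e : env k.+1 => G e.1 e.2) ->
  computes (fun e : env k.+2 => G e.1.1 e.2).
Proof.
apply: (@computes_rename k.+1 k.+2 (fun e => (e.1.1, e.2))
  (fun r => if r is [:: a, b & r'] then a :: r' else [::])) => //.
- by move=> [|a [|b r]] // j; rewrite !inE => /orP [->//|->]; rewrite !orbT.
- by move=> [[e i] j]; rewrite /scale /= leq_add2l leq_add2l leq_addl.
- by move=> [|a [|b r]] [[e i] j] s [//= [E _ R] M]; split=> //=; rewrite E R.
Qed.

(** The body sees the accumulator as a variable, so its time is controlled by a scale that contains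
    the accumulator. Iterating unrestricted polynomial growth would leave the class; hence the bound
    [A] on all partial results. *)
Lemma computes_iteri k (N Z A : env k -> nat) (G : env k -> nat -> nat -> nat) :
  computes N -> computes Z ->
  computes (fun y : env k.+2 => G y.1.1 y.1.2 y.2) ->
  poly_bounded A -> (forall e i, i <= N e -> iteri i (G e) (Z e) <= A e) ->
  computes (fun e => iteri (N e) (G e) (Z e)).
Proof.
move=> [BN HN] [BZ HZ] [_ HG] BA leA; split.
  by apply: poly_bounded_le BA => e; apply: leA.
move=> r d rd.
have rd1 := all_ltn_weak (leqnSn d) rd.
have rd4 : all (ltn^~ (d + 4)) [:: d, d + 2 & r].
  by rewrite /= (all_ltn_weak _ rd) ?leq_addr // andbT; lia.
have [cZ [TZ [BTZ RZ]]] := HZ _ _ rd.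
have [cN [TN [BTN RN]]] := HN _ _ rd1.
have [cG [TG [[m BTG] RG]]] := HG _ _ rd4.
(* The scale of the extended environment is [scale e] plus the index plus the accumulator. *)
pose U (e : env k) := (scale e + N e + A e) ^ m.
pose body := Seq cG (Seq (Const (d + 5) 0) (Seq (Add d (d + 4) (d + 5))
  (Seq (Defs.Sub d.+1 d.+1 (d + 3)) (Add (d + 2) (d + 2) (d + 3))))).
(* Registers d to d + 4: accumulator, remaining iterations, index, the constant
   1 and the value of G. *)
exists (Seq cZ (Seq cN (Seq (Const (d + 2) 0)
  (Seq (Const (d + 3) 1) (While d.+1 body))))).
(* Each round adds four instructions and the loop test to the time of [cG]; the last 1 is the
   failing test. *)
exists (fun e => TZ e + (TN e + (1 + (1 + (N e * (U e + 5) + 1))))); split.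
  have C := poly_bounded_const.
  have BU : poly_bounded U.
    apply: poly_bounded_exp; do 2 apply: poly_bounded_add => //.
    exact: poly_bounded_scale.
  by do !(apply: poly_bounded_add || apply: poly_bounded_mul).
have loop e q : forall i s, i + q = N e -> holds r e s ->
    regs s d = iteri i (G e) (Z e) -> regs s d.+1 = q -> regs s (d + 2) = i ->
    regs s (d + 3) = 1 -> exists t s',
    [/\ exec (compare_alternatives (inst e)) (While d.+1 body) s t s',
        t <= q * (U e + 5) + 1, regs s' d = iteri (N e) (G e) (Z e),
        forall j, j < d -> regs s' j = regs s j & Defs.mem s' = Defs.mem s].
  elim: q => [|q IH] i s.
    rewrite addn0 => <- H acc rem _ _; exists 1, s; split=> //.
    exact: ExecWhileFalse.
  move=> iq H acc rem idx one.
  have leiN : i <= N e by rewrite -iq leq_addr.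
  have H' : holds (k := k.+2) [:: d, d + 2 & r] (e, i, iteri i (G e) (Z e)) s.
    by case: H => Hr Hm; split=> //=; rewrite Hr acc idx.
  have [t [s1 [X tT [R] P M]]] := RG _ _ H'.
  have s1i : regs s1 (d + 2) = i by rewrite P // ltn_add2l.
  have s1q : regs s1 d.+1 = q.+1 by rewrite P // -addn1 ltn_add2l.
  have s11 : regs s1 (d + 3) = 1 by rewrite P // ltn_add2l.
  set s2 := set_reg s1 (d + 5) 0.
  set s3 := set_reg s2 d (regs s2 (d + 4) + regs s2 (d + 5)).
  set s4 := set_reg s3 d.+1 (regs s3 d.+1 - regs s3 (d + 3)).
  set s5 := set_reg s4 (d + 2) (regs s4 (d + 2) + regs s4 (d + 3)).
  have P5 j : j < d -> regs s5 j = regs s j.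
    by move=> jd /=; rewrite !ifN_eq ?P; lia.
  have M5 : Defs.mem s5 = Defs.mem s by [].
  have [||||||t' [s' [X' tT' R' P' M']]] := IH i.+1 s5.
  - by rewrite addSnnS.
  - exact: holds_eq rd P5 M5 H.
  - have e1 : (d == d + 2) = false by lia.
    have e2 : (d == d.+1) = false by lia.
    have e3 : (d + 4 == d + 5) = false by lia.
    by rewrite /= e1 e2 !eqxx e3 addn0 R.
  - have e1 : (d.+1 == d + 2) = false by lia.
    have e2 : (d.+1 == d) = false by lia.
    have e3 : (d.+1 == d + 5) = false by lia.
    have e4 : (d + 3 == d) = false by lia.
    have e5 : (d + 3 == d + 5) = false by lia.
    by rewrite /= !eqxx e1 e2 e3 e4 e5 s1q s11 subn1.
  - have e1 : (d + 2 == d.+1) = false by lia.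
    have e2 : (d + 2 == d) = false by lia.
    have e3 : (d + 2 == d + 5) = false by lia.
    have e4 : (d + 3 == d) = false by lia.
    have e5 : (d + 3 == d + 5) = false by lia.
    have e6 : (d + 3 == d.+1) = false by lia.
    by rewrite /= !eqxx e1 e2 e3 e4 e5 e6 s1i s11 addn1.
  - have e3 : (d + 3 == d + 2) = false by lia.
    have e4 : (d + 3 == d) = false by lia.
    have e5 : (d + 3 == d + 5) = false by lia.
    have e6 : (d + 3 == d.+1) = false by lia.
    by rewrite /= e3 e4 e5 e6.
  exists ((t + (1 + (1 + (1 + 1)))) + t').+1, s'; split=> //.
  - apply: ExecWhileTrue X'; first by rewrite rem.
    apply: ExecSeq X _; apply: ExecSeq; first exact: ExecConst.
    apply: ExecSeq; first exact: ExecAdd.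
    by apply: ExecSeq; [apply: ExecSub|apply: ExecAdd].
  - have tU : t <= U e.
      apply: leq_trans tT (leq_trans (BTG _) _).
      rewrite /U; case: (m) => // m'; rewrite leq_exp2r //.
      have := leA e i leiN; rewrite /scale /=; lia.
    by rewrite mulSn; lia.
  - by move=> j jd; rewrite P' // P5.
  - by rewrite M' M5.
move=> e s H.
have [t1 [s1 [X1 tT1 [R1] P1 M1]]] := RZ e s H.
have H1 := holds_eq rd P1 M1 H.
have [t2 [s2 [X2 tT2 [R2] P2 M2]]] := RN e s1 H1.
have H2 := holds_eq rd1 P2 M2 H1.
set s3 := set_reg s2 (d + 2) 0; set s4 := set_reg s3 (d + 3) 1.
have P4 j : j < d.+2 -> regs s4 j = regs s2 j.
  by move=> jd /=; rewrite !ifN_eq; lia.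
have H4 : holds r e s4.
  by apply: (@holds_eq _ r d) H2 => // j jd; apply: P4; lia.
have [||||||t' [s' [X' tT' R' P' M']]] := loop e (N e) 0 s4 => //.
- by rewrite P4 // P2.
- by rewrite P4.
- have e3 : (d + 2 == d + 3) = false by lia.
  by rewrite /= e3 eqxx.
- by rewrite /= eqxx.
exists (t1 + (t2 + (1 + (1 + t')))), s'; split=> //.
- apply: ExecSeq X1 _; apply: ExecSeq X2 _.
  apply: ExecSeq; first exact: ExecConst.
  by apply: ExecSeq X'; apply: ExecConst.
- lia.
- by rewrite /= R'.
- by move=> j jd; rewrite P' // P4 ?P2 ?P1 //; lia.
- by rewrite M' /= M2 M1.
Qed.

(** * Arithmetic and bounded quantifiers *)

Section Derived.
Variable k : nat.
Implicit Types (F G N : env k -> nat) (P Q : env k -> bool).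

Lemma computes_nplayers : computes (fun e : env k => nplayers (inst e)).
Proof.
apply: computes_ext (computes_nth_vars (j := k) _); last by rewrite addn2.
exact: nth_vars_nplayers.
Qed.

Lemma computes_nactivities : computes (fun e : env k => nactivities (inst e)).
Proof.
apply: computes_ext (computes_nth_vars (j := k.+1) _); last by rewrite addn2.
exact: nth_vars_nactivities.
Qed.

Lemma computes_succ F : computes F -> computes (fun e => (F e).+1).
Proof.
move=> HF; apply: computes_ext (computes_add HF (computes_const k 1)) => e.
exact: addn1.
Qed.

Lemma decides_not P : decides P -> decides (fun e => ~~ P e).
Proof.
move=> HP; apply: computes_ext (computes_sub (computes_const k 1) HP) => e.
by case: (P e).
Qed.

Lemma decides_leq F G : computes F -> computes G -> decides (fun e => F e <= G e).
Proof.
move=> HF HG; pose H := computes_sub (computes_const k 1) (computes_sub HF HG).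
by apply: computes_ext H => e; rewrite /leq; case: (F e - G e).
Qed.

Lemma decides_and P Q : decides P -> decides Q -> decides (fun e => P e && Q e).
Proof.
move=> HP HQ.
have /decides_not HN := decides_leq (computes_add HP HQ) (computes_const k 1).
by apply: computes_ext HN => e; case: (P e); case: (Q e).
Qed.

Lemma decides_or P Q : decides P -> decides Q -> decides (fun e => P e || Q e).
Proof.
move=> HP HQ; have HN := decides_leq (computes_const k 1) (computes_add HP HQ).
by apply: computes_ext HN => e; case: (P e); case: (Q e).
Qed.

Lemma decides_imp P Q : decides P -> decides Q -> decides (fun e => P e ==> Q e).
Proof.
move=> HP HQ; apply: computes_ext (decides_or (decides_not HP) HQ) => e.
by rewrite implybE.
Qed.

Lemma decides_eq F G : computes F -> computes G -> decides (fun e => F e == G e).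
Proof.
move=> HF HG.
apply: computes_ext (decides_and (decides_leq HF HG) (decides_leq HG HF)) => e.
by rewrite eqn_leq.
Qed.

End Derived.

Lemma computes_last k : computes (fun e : env k.+1 => e.2).
Proof. exact: computes_ext (computes_nth_vars (j := 0) _). Qed.

(** The loop behind all bounded quantifiers: [has] and [all] compare the count with 0 and with the
    range. Partial counts never exceed the range, which bounds the accumulator. *)
Lemma computes_count k (N : env k -> nat) (P : env k -> nat -> bool) :
  computes N -> decides (fun y : env k.+1 => P y.1 y.2) ->
  computes (fun e => count (P e) (iota 0 (N e))).
Proof.
move=> HN HP.
have E e n : iteri n (fun i a => a + P e i) 0 = count (P e) (iota 0 n).
  by elim: n => // n IH; rewrite [LHS]/= IH -[in RHS]addn1 iotaD count_cat /= addn0.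
apply: (computes_ext (fun e => E e (N e))).
apply: (computes_iteri (A := N)) => //.
- exact: computes_const.
- by apply: computes_add (computes_last _) _; apply: computes_weaken HP.
- by case: HN.
- by move=> e i; rewrite E; apply: leq_trans; rewrite -{2}(size_iota 0 i) count_size.
Qed.

Lemma decides_has k (N : env k -> nat) (P : env k -> nat -> bool) :
  computes N -> decides (fun y : env k.+1 => P y.1 y.2) ->
  decides (fun e => has (P e) (iota 0 (N e))).
Proof.
move=> HN HP.
apply: computes_ext (decides_leq (computes_const k 1) (computes_count HN HP)) => e.
by rewrite has_count.
Qed.

Lemma decides_all k (N : env k -> nat) (P : env k -> nat -> bool) :
  computes N -> decides (fun y : env k.+1 => P y.1 y.2) ->
  decides (fun e => all (P e) (iota 0 (N e))).
Proof.
move=> HN HP; apply: computes_ext (decides_eq (computes_count HN HP) HN) => e.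
by rewrite all_count size_iota.
Qed.

Lemma decides_weaken_under k (P : env k -> nat -> bool) :
  decides (fun y : env k.+1 => P y.1 y.2) ->
  decides (fun y : env k.+2 => P y.1.1 y.2).
Proof. exact: (@computes_weaken_under k (fun e i => P e i)). Qed.

(** Substituting a computed value is not a renaming of registers. It becomes a search for the index
    that equals [F e], at the cost of a polynomial factor. *)
Lemma decides_app k (P : env k -> nat -> bool) (F : env k -> nat) :
  decides (fun y : env k.+1 => P y.1 y.2) -> computes F ->
  decides (fun e => P e (F e)).
Proof.
move=> HP HF.
have H : decides (fun e => has (fun i => (i == F e) && P e i) (iota 0 (F e).+1)).
  apply: decides_has; first exact: computes_succ.
  apply: decides_and _ HP; exact: decides_eq (computes_last _) (computes_weaken HF).
apply: computes_ext H => e; congr (nat_of_bool _).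
apply/hasP/idP => [[i _ /andP [/eqP ->]] //|PF].
by exists (F e); rewrite ?mem_iota ?add0n ?ltnSn /= ?eqxx.
Qed.

Lemma computes_mul k (F G : env k -> nat) :
  computes F -> computes G -> computes (fun e => F e * G e).
Proof.
move=> HF HG.
have E e n : iteri n (fun _ a => a + G e) 0 = n * G e.
  by elim: n => //= n ->; rewrite mulSn addnC.
apply: (computes_ext (fun e => E e (F e))).
apply: (computes_iteri (A := fun e => F e * G e)) => //.
- exact: computes_const.
- exact: computes_add (computes_last _) (computes_weaken (computes_weaken HG)).
- by case: HF HG => ? _ [? _]; apply: poly_bounded_mul.
- by move=> e i iF; rewrite E leq_mul.
Qed.

(** A power can leave the class, hence the explicit bound. The base is a successor so that the final
    power dominates the intermediate ones. *)
Lemma computes_exp k (F N : env k -> nat) :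
  computes F -> computes N -> poly_bounded (fun e => (F e).+1 ^ N e) ->
  computes (fun e => (F e).+1 ^ N e).
Proof.
move=> HF HN HA.
have E e n : iteri n (fun _ a => a * (F e).+1) 1 = (F e).+1 ^ n.
  by elim: n => //= n ->; rewrite expnS mulnC.
apply: (computes_ext (fun e => E e (N e))); apply: (computes_iteri _ _ _ HA) => //.
- exact: computes_const.
- apply: computes_mul (computes_last _) _.
  exact: computes_weaken (computes_weaken (computes_succ HF)).
- by move=> e i iN; rewrite E leq_pexp2l.
Qed.

(** The quotient is the number of positive multiples of the divisor that do not exceed [F e], which
    bounded counting provides. *)
Lemma computes_div k (F G : env k -> nat) :
  computes F -> computes G -> computes (fun e => F e %/ (G e).+1).
Proof.
move=> HF HG.
have E e : count (fun q => q.+1 * (G e).+1 <= F e) (iota 0 (F e)) = F e %/ (G e).+1.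
  rewrite (eq_count (a2 := fun q => q < F e %/ (G e).+1)); last first.
    by move=> q; rewrite leq_divRL.
  have: F e %/ (G e).+1 <= F e by apply: leq_div.
  move: (_ %/ _) => m; move: (F e) => n mn; rewrite -(subnKC mn) iotaD count_cat add0n.
  rewrite [X in X + _](_ : _ = m) ?[X in _ + X](_ : _ = 0) ?addn0 //.
    apply/eqP; rewrite -leqn0 leqNgt -has_count; apply/hasPn => q.
    by rewrite mem_iota; lia.
  rewrite -[RHS](size_iota 0); apply/eqP; rewrite -all_count; apply/allP => q.
  by rewrite mem_iota.
apply: (computes_ext E); apply: computes_count => //.
apply: decides_leq; last exact: computes_weaken HF.
apply: computes_mul; first by apply: computes_succ; apply: computes_last.
exact: computes_weaken (computes_succ HG).
Qed.

Lemma computes_mod k (F G : env k -> nat) :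
  computes F -> computes G -> computes (fun e => F e %% (G e).+1).
Proof.
move=> HF HG.
pose H := computes_sub HF (computes_mul (computes_div HF HG) (computes_succ HG)).
apply: computes_ext H => e.
by rewrite modn_def {1}(divn_eq (F e) (G e).+1) addKn modn_def.
Qed.

(* Iterated division instead of division by b ^ i keeps all the intermediate
   results below c. *)
Definition digit (b c i : nat) : nat := iteri i (fun _ a => a %/ b) c %% b.

Lemma computes_digit k (B C J : env k -> nat) :
  computes B -> computes C -> computes J ->
  computes (fun e => digit (B e).+1 (C e) (J e)).
Proof.
move=> HB HC HJ; apply: computes_mod => //.
apply: (computes_iteri (A := C)) => //.
- exact: computes_div (computes_last _) (computes_weaken (computes_weaken HB)).
- by case: HC.
- move=> e i _; elim: i => //= i; apply: leq_trans; exact: leq_div.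
Qed.

(** Horner's rule with [f 0] as the lowest digit, by induction on the shifted sequence. *)
Lemma digit_exists n b (f : nat -> nat) : (forall i, f i < b) ->
  exists2 c, c < b ^ n & forall i, i < n -> digit b c i = f i.
Proof.
move=> fb; have b0 : 0 < b := leq_ltn_trans (leq0n _) (fb 0).
elim: n f fb => [|n IH] f fb; first by exists 0.
have [c cn Hc] := IH (f \o succn) (fun i => fb i.+1).
exists (c * b + f 0).
  rewrite expnS mulnC; apply: (@leq_trans (c.+1 * b)).
    by rewrite mulSn; have := fb 0; lia.
  by rewrite mulnC leq_mul2l cn orbT.
case=> [_|i]; first by rewrite /digit /= modnMDl modn_small.
rewrite ltnS => /Hc /= <-; rewrite /digit; congr (_ %% b).
elim: i => /= [|i <- //]; by rewrite divnMDl // divn_small ?addn0.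
Qed.

(** * Stability as a formula on codes *)

Section Formulas.
Variable I : gGASP.
Local Notation n := (nplayers I).
Local Notation p := (nactivities I).

(** The offset skips the unary n and p with their two separators; the matrix is stored row by
    row. *)
Definition edge_code (i j : nat) : bool :=
  nth false (encode I) (n + p + 2 + i * n + j).

Definition bit (S i : nat) : bool := 0 < digit 2 S i.

(* As in [activity_code], 0 is the void activity and a.+1 the activity a. *)
Definition act (c i : nat) : nat := digit p.+1 c i.

Definition popcount (S : nat -> bool) : nat := count S (iota 0 n).

(* S is connected iff every cut T of S is crossed by an edge; this formula has
   only bounded quantifiers. *)
Definition connected_code (S : nat -> bool) : bool :=
  all (fun T => all (fun u => all (fun v =>
    [&& S u, bit T u, S v & ~~ bit T v] ==>
      has (fun x => has (fun y =>
        [&& S x, bit T x, S y, ~~ bit T y & edge_code x y])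
      (iota 0 n)) (iota 0 n))
    (iota 0 n)) (iota 0 n)) (iota 0 (2 ^ n)).

(** [0 < act c i] prevents players of the void activity from forming a common group; [j == i] leaves
    each of them in a singleton. *)
Definition group_code (c i j : nat) : bool :=
  (j == i) || (0 < act c i) && (act c j == act c i).

Definition prefers_code (i a k b l : nat) : bool :=
  compare_alternatives I [:: i; a; k; b; l].

Definition sprefers_code (i a k b l : nat) : bool :=
  prefers_code i a k b l && ~~ prefers_code i b l a k.

Definition feasible_code (c : nat) : bool :=
  all (fun i => connected_code (group_code c i)) (iota 0 n).

Definition rational_code (c : nat) : bool :=
  all (fun i => prefers_code i (act c i) (popcount (group_code c i)) 0 1) (iota 0 n).

Definition core_code (c S a : nat) : bool :=
  [&& has (bit S) (iota 0 n), connected_code (bit S),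
    all (fun j => (act c j == a.+1) ==> bit S j) (iota 0 n) &
    all (fun i => bit S i ==>
      sprefers_code i a.+1 (popcount (bit S))
        (act c i) (popcount (group_code c i)))
    (iota 0 n)].

Definition core_block_code (c : nat) : bool :=
  has (fun S => has (core_code c S) (iota 0 p)) (iota 0 (2 ^ n)).

Definition NS_code (c i a : nat) : bool :=
  [&& act c i != a.+1,
    connected_code (fun j => (j == i) || (act c j == a.+1)) &
    sprefers_code i a.+1 (popcount (fun j => act c j == a.+1)).+1
      (act c i) (popcount (group_code c i))].

Definition NS_block_code (c : nat) : bool :=
  has (fun i => has (NS_code c i) (iota 0 p)) (iota 0 n).

Definition IS_code (c i a : nat) : bool :=
  NS_code c i a &&
  all (fun j => (act c j == a.+1) ==>
    prefers_code j a.+1 (popcount (fun j => act c j == a.+1)).+1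
      a.+1 (popcount (fun j => act c j == a.+1)))
  (iota 0 n).

Definition IS_block_code (c : nat) : bool :=
  has (fun i => has (IS_code c i) (iota 0 p)) (iota 0 n).

Definition stable_code (block : nat -> bool) : bool :=
  has (fun c => [&& feasible_code c, rational_code c & ~~ block c])
    (iota 0 (p.+1 ^ n)).

End Formulas.

(** * Computability of the stability formulas *)

Lemma poly_bounded_scale0 k (F : env k -> nat) :
  (forall e, F e <= scale0 (inst e)) -> poly_bounded F.
Proof.
move=> HF; apply: poly_bounded_le (@poly_bounded_scale k) => e.
exact: leq_trans (HF e) (leq_addr _ _).
Qed.

Lemma computes_exp2_nplayers k : computes (fun e : env k => 2 ^ nplayers (inst e)).
Proof.
apply: (computes_exp (F := fun=> 1)).
- exact: computes_const.
- exact: computes_nplayers.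
apply: poly_bounded_scale0 => e; rewrite /scale0.
move: (nplayers _) (nactivities _) => n p.
apply: (@leq_trans (2 ^ n.+1)); first by rewrite leq_exp2l.
by rewrite leq_exp2r // leq_addl.
Qed.

Lemma computes_num_assignments k :
  computes (fun e : env k => (nactivities (inst e)).+1 ^ nplayers (inst e)).
Proof.
apply: computes_exp; [exact: computes_nactivities|exact: computes_nplayers|].
apply: poly_bounded_scale0 => e; rewrite /scale0.
move: (nplayers _) (nactivities _) => n p.
apply: (@leq_trans (p.+1 ^ n.+1)); first by rewrite leq_pexp2l.
by rewrite leq_exp2r //; lia.
Qed.

Section Decide.
Variable k : nat.
Implicit Types F G C : env k -> nat.

Lemma decides_edge F G : computes F -> computes G ->
  decides (fun e => edge_code (inst e) (F e) (G e)).
Proof.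
move=> HF HG; apply: decides_read.
apply: computes_add HG; apply: computes_add.
  apply: computes_add (computes_const _ _).
  exact: computes_add (computes_nplayers _) (computes_nactivities _).
exact: computes_mul HF (computes_nplayers _).
Qed.

Lemma decides_bit F G : computes F -> computes G -> decides (fun e => bit (F e) (G e)).
Proof.
move=> HF HG; apply: decides_leq (computes_const _ _) _.
exact: computes_digit (computes_const _ 1) HF HG.
Qed.

Lemma computes_act F G : computes F -> computes G ->
  computes (fun e => act (inst e) (F e) (G e)).
Proof. exact: computes_digit (computes_nactivities _). Qed.

Lemma computes_popcount (S : env k -> nat -> bool) :
  decides (fun y : env k.+1 => S y.1 y.2) ->
  computes (fun e => popcount (inst e) (S e)).
Proof. exact: computes_count (computes_nplayers _). Qed.

Lemma decides_prefers F1 F2 F3 F4 F5 :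
  computes F1 -> computes F2 -> computes F3 -> computes F4 -> computes F5 ->
  decides (fun e => prefers_code (inst e) (F1 e) (F2 e) (F3 e) (F4 e) (F5 e)).
Proof. exact: decides_compare. Qed.

Lemma decides_sprefers F1 F2 F3 F4 F5 :
  computes F1 -> computes F2 -> computes F3 -> computes F4 -> computes F5 ->
  decides (fun e => sprefers_code (inst e) (F1 e) (F2 e) (F3 e) (F4 e) (F5 e)).
Proof.
move=> H1 H2 H3 H4 H5; apply: decides_and; first exact: decides_prefers.
by apply: decides_not; apply: decides_prefers.
Qed.

End Decide.

Lemma decides_connected k (S : env k -> nat -> bool) :
  decides (fun y : env k.+1 => S y.1 y.2) ->
  decides (fun e => connected_code (inst e) (S e)).
Proof.
move=> HS.
(* [S] is carried under the binders T, u, v and then x, y, its own argument staying the newest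
   variable. [V0] to [V4] are de Bruijn indices: T is [V2] inside the first three binders and [V4]
   inside all five. *)
have HS1 := decides_weaken_under HS.
have HS2 := decides_weaken_under (P := fun e : env k.+1 => S e.1) HS1.
have HS3 := decides_weaken_under (P := fun e : env k.+2 => S e.1.1) HS2.
have HS4 := decides_weaken_under (P := fun e : env k.+3 => S e.1.1.1) HS3.
have HS5 := decides_weaken_under (P := fun e : env k.+4 => S e.1.1.1.1) HS4.
have V0 j := @computes_last j; have V1 j := computes_weaken (V0 j).
have V2 j := computes_weaken (V1 j).
have V4 j := computes_weaken (computes_weaken (V2 j)).
have inS3 (F : env k.+3 -> nat) :
    computes F -> decides (fun e : env k.+3 => S e.1.1.1 (F e)).
  exact: (decides_app (P := fun e : env k.+3 => S e.1.1.1) HS3).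
have inS5 (F : env k.+4.+1 -> nat) :
    computes F -> decides (fun e : env k.+4.+1 => S e.1.1.1.1.1 (F e)).
  exact: (decides_app (P := fun e : env k.+4.+1 => S e.1.1.1.1.1) HS5).
have N j := @computes_nplayers j.
apply: decides_all; first exact: computes_exp2_nplayers.
do 2 apply: decides_all => //; apply: decides_imp.
  apply: decides_and; first exact: inS3 (V1 _).
  apply: decides_and; first exact: decides_bit (V2 _) (V1 _).
  apply: decides_and; first exact: inS3 (V0 _).
  by apply: decides_not; apply: decides_bit (V2 _) (V0 _).
do 2 apply: decides_has => //.
apply: decides_and; first exact: inS5 (V1 _).
apply: decides_and; first exact: decides_bit (V4 _) (V1 _).
apply: decides_and; first exact: inS5 (V0 _).
apply: decides_and; last exact: decides_edge (V1 _) (V0 _).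
by apply: decides_not; apply: decides_bit (V4 _) (V0 _).
Qed.

Lemma decides_group k (C F G : env k -> nat) :
  computes C -> computes F -> computes G ->
  decides (fun e => group_code (inst e) (C e) (F e) (G e)).
Proof.
move=> HC HF HG; apply: decides_or; first exact: decides_eq.
apply: decides_and; last by apply: decides_eq; apply: computes_act.
exact: decides_leq (computes_const _ _) (computes_act HC HF).
Qed.


Lemma decides_eq_act k (C A F : env k -> nat) :
  computes C -> computes A -> computes F ->
  decides (fun e => act (inst e) (C e) (F e) == (A e).+1).
Proof.
by move=> HC HA HF; apply: decides_eq; [apply: computes_act|apply: computes_succ].
Qed.

Lemma computes_card_group k (C F : env k -> nat) : computes C -> computes F ->
  computes (fun e => popcount (inst e) (group_code (inst e) (C e) (F e))).
Proof.
move=> HC HF; apply: computes_popcount; apply: decides_group; last exact: computes_last.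
  exact: computes_weaken HC.
exact: computes_weaken HF.
Qed.

Lemma computes_card_act k (C A : env k -> nat) : computes C -> computes A ->
  computes (fun e => popcount (inst e) (fun j => act (inst e) (C e) j == (A e).+1)).
Proof.
move=> HC HA; apply: computes_popcount.
apply: decides_eq_act; last exact: computes_last.
  exact: computes_weaken HC.
exact: computes_weaken HA.
Qed.

Lemma decides_feasible k (C : env k -> nat) :
  computes C -> decides (fun e => feasible_code (inst e) (C e)).
Proof.
move=> HC; apply: decides_all; first exact: computes_nplayers.
apply: decides_connected; apply: decides_group; last exact: computes_last.
  exact: computes_weaken (computes_weaken HC).
exact: computes_weaken (computes_last _).
Qed.

Lemma decides_rational k (C : env k -> nat) :
  computes C -> decides (fun e => rational_code (inst e) (C e)).
Proof.
move=> HC; apply: decides_all; first exact: computes_nplayers.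
have HC1 := computes_weaken HC; have L := @computes_last k.
apply: decides_prefers => //; try exact: computes_const.
  exact: computes_act.
exact: computes_card_group.
Qed.

Lemma decides_NS k (C F A : env k -> nat) : computes C -> computes F -> computes A ->
  decides (fun e => NS_code (inst e) (C e) (F e) (A e)).
Proof.
move=> HC HF HA; apply: decides_and; first by apply: decides_not; apply: decides_eq_act.
have L := @computes_last k.
have W := @computes_weaken k.
apply: decides_and.
  apply: decides_connected; apply: decides_or; first exact: decides_eq L (W _ HF).
  exact: decides_eq_act (W _ HC) (W _ HA) L.
apply: decides_sprefers => //.
- exact: computes_succ.
- by apply: computes_succ; apply: computes_card_act.
- exact: computes_act.
- exact: computes_card_group.
Qed.

Lemma decides_NS_block k (C : env k -> nat) :
  computes C -> decides (fun e => NS_block_code (inst e) (C e)).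
Proof.
move=> HC; apply: decides_has; first exact: computes_nplayers.
apply: decides_has; first exact: computes_nactivities.
apply: decides_NS (computes_last _); first exact: computes_weaken (computes_weaken HC).
exact: computes_weaken (computes_last _).
Qed.

Lemma decides_IS k (C F A : env k -> nat) :
  computes C -> computes F -> computes A ->
  decides (fun e => IS_code (inst e) (C e) (F e) (A e)).
Proof.
move=> HC HF HA; apply: decides_and; first exact: decides_NS.
have L := @computes_last k.
have HC1 := computes_weaken HC; have HA1 := computes_weaken HA.
have HS := computes_succ HA1; have HM := computes_card_act HC1 HA1.
apply: decides_all; first exact: computes_nplayers.
apply: decides_imp; first exact: decides_eq_act.
exact: (decides_prefers L HS (computes_succ HM) HS HM).
Qed.

Lemma decides_IS_block k (C : env k -> nat) :
  computes C -> decides (fun e => IS_block_code (inst e) (C e)).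
Proof.
move=> HC; apply: decides_has; first exact: computes_nplayers.
apply: decides_has; first exact: computes_nactivities.
apply: decides_IS (computes_last _); first exact: computes_weaken (computes_weaken HC).
exact: computes_weaken (computes_last _).
Qed.

Lemma decides_core k (C S A : env k -> nat) :
  computes C -> computes S -> computes A ->
  decides (fun e => core_code (inst e) (C e) (S e) (A e)).
Proof.
move=> HC HS HA; have L := @computes_last k; have N m := @computes_nplayers m.
have HC1 := computes_weaken HC; have HA1 := computes_weaken HA.
have HS1 := computes_weaken HS; have HS2 := computes_weaken HS1.
apply: decides_and; first by apply: decides_has => //; apply: decides_bit.
apply: decides_and; first by apply: decides_connected; apply: decides_bit.
apply: decides_and; apply: decides_all => //.
  by apply: decides_imp; [apply: decides_eq_act|apply: decides_bit].
apply: decides_imp; first exact: decides_bit.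
apply: decides_sprefers => //.
- exact: computes_succ.
- by apply: computes_popcount; apply: decides_bit => //; apply: computes_last.
- exact: computes_act.
- exact: computes_card_group.
Qed.

Lemma decides_core_block k (C : env k -> nat) :
  computes C -> decides (fun e => core_block_code (inst e) (C e)).
Proof.
move=> HC; apply: decides_has; first exact: computes_exp2_nplayers.
apply: decides_has; first exact: computes_nactivities.
apply: decides_core (computes_last _).
  exact: computes_weaken (computes_weaken HC).
exact: computes_weaken (computes_last _).
Qed.

Lemma decides_stable (block : gGASP -> nat -> bool) :
  decides (fun y : env 1 => block y.1 y.2) ->
  decides (fun e : env 0 => stable_code e (block e)).
Proof.
move=> HB; apply: decides_has; first exact: (computes_num_assignments 0).
have L := computes_last 0.
apply: decides_and; first exact: (decides_feasible L).
by apply: decides_and; [exact: (decides_rational L)|exact: decides_not].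
Qed.

(** * Correctness of the coding *)

Lemma all_iotaP m (P : pred nat) :
  reflect (forall i : 'I_m, P i) (all P (iota 0 m)).
Proof.
apply: (iffP allP) => [H i|H i]; first by apply: H; rewrite mem_iota /= ltn_ord.
by rewrite mem_iota => im; apply: (H (Ordinal im)).
Qed.

Lemma has_iotaP m (P : pred nat) :
  reflect (exists i : 'I_m, P i) (has P (iota 0 m)).
Proof.
apply: (iffP hasP) => [[i]|[i Pi]]; last first.
  by exists (i : nat); rewrite // mem_iota /= ltn_ord.
by rewrite mem_iota => im Pi; exists (Ordinal im).
Qed.

Lemma count_iota m (P : pred nat) (A : {set 'I_m}) :
  (forall i : 'I_m, P i = (i \in A)) -> count P (iota 0 m) = #|A|.
Proof.
move=> PA; rewrite -val_enum_ord count_map enumT cardE /enum_mem size_filter.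
by apply: eq_count => i /=; rewrite PA.
Qed.

Lemma activity_code_inj p : injective (@activity_code p).
Proof. by case=> [a|] [b|] //= [/val_inj ->]. Qed.

Section Coding.
Variable I : gGASP.
Local Notation n := (nplayers I).
Local Notation p := (nactivities I).
Implicit Types (i j : player I) (a : 'I_p) (S : {set player I}).

Lemma edge_codeE i j : edge_code I i j = edge i j.
Proof.
(* Stated for an arbitrary list [s] of rows, so that induction can remove one row of length n at a
   time. *)
have nth_row (s : seq 'I_n) k : k < size s ->
    nth false [seq edge x y | x <- s, y <- enum 'I_n] (k * n + j) = edge (nth i s k) j.
  elim: s k => //= x s IH [|k] ks; rewrite nth_cat size_map size_enum_ord.
    by rewrite mul0n add0n ltn_ord (nth_map i) ?size_enum_ord // nth_ord_enum.
  by rewrite mulSn -addnA ltnNge leq_addr /= addKn IH.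
rewrite /edge_code /encode nth_cat size_nseq ifF; last lia.
have -> : n + p + 2 + i * n + j - n = (p + 1 + i * n + j).+1 by lia.
rewrite /= nth_cat size_nseq ifF; last lia.
have -> : p + 1 + i * n + j - p = (i * n + j).+1 by lia.
rewrite /= nth_cat ifT ?nth_row ?size_enum_ord ?nth_ord_enum //.
rewrite size_allpairs size_enum_ord.
have := ltn_ord i; have := ltn_ord j; nia.
Qed.

Lemma bits_exist S : exists2 t, t < 2 ^ n & forall i, bit t i = (i \in S).
Proof.
pose f k : nat := if insub k is Some i then i \in S else false.
have [|t tn Ht] := @digit_exists n 2 f.
  by move=> k; rewrite /f; case: insub => // i; case: (i \in S).
exists t => // i; by rewrite /bit Ht // /f valK lt0b.
Qed.

(** If [i] cannot reach [j] inside S, the set reachable from [i] is a cut of S that no edge leaves.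
    Conversely, a path from inside T to outside T has a first step leaving T, found by induction on
    the path. *)
Lemma connected_codeE (s : nat -> bool) S :
  (forall i, s i = (i \in S)) -> connected_code I s = connected S.
Proof.
move=> sS; apply/idP/idP => [/all_iotaP cut | /'forall_in_forall_inP conn].
  apply/forall_inP => i iS; apply/forall_inP => j jS; apply: contraT => Nij.
  set e := (X in connect X i j) in Nij.
  have [t tn Ht] := bits_exist [set x | connect e i x].
  have {}Ht (x : player I) : bit t x = connect e i x by rewrite Ht inE.
  move/all_iotaP/(_ i)/all_iotaP/(_ j): (cut (Ordinal tn)).
  rewrite /= !sS iS jS !Ht connect0 Nij /= => /has_iotaP [x /has_iotaP [y]].
  rewrite !sS !Ht edge_codeE => /and5P [xS ix yS Niy xy].
  by case/negP: Niy; apply: connect_trans ix (connect1 _); rewrite /e /= xS yS.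
apply/all_iotaP => t; apply/all_iotaP => u; apply/all_iotaP => v; apply/implyP.
rewrite !sS => /and4P [uS tu vS tv].
have /connectP [q uq Ev] := conn u uS v vS; rewrite {}Ev in tv.
elim: q u {uS} uq tu tv => [|w q IH] u /=; first by move=> _ ->.
case/andP=> /and3P [uS wS uw] wq tu tv.
case tw : (bit t w); first exact: (IH w).
apply/has_iotaP; exists u; apply/has_iotaP; exists w.
by rewrite !sS uS wS tu tw edge_codeE uw.
Qed.

Lemma popcountE (s : nat -> bool) S :
  (forall i, s i = (i \in S)) -> popcount I s = #|S|.
Proof. exact: count_iota. Qed.

Lemma card_players S i : i \in S -> 0 < #|S| <= n.
Proof.
move=> iS; apply/andP; split; first by apply/card_gt0P; exists i.
by rewrite -[X in _ <= X]card_ord max_card.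
Qed.

Lemma card_players_lt S i : i \notin S -> #|S| < n.
Proof.
move=> iS; rewrite -[X in _ < X]card_ord -cardsT; apply: proper_card.
apply/properP; split; [exact: subsetT|by exists i].
Qed.

Lemma mem_alternatives_None : (None, 1) \in alternatives n p.
Proof. exact: mem_head. Qed.

Lemma mem_alternatives_Some a k : 0 < k <= n -> (Some a, k) \in alternatives n p.
Proof.
move=> kn; rewrite inE /=; apply/allpairsP; exists (a, k).
by rewrite mem_enum mem_iota add1n ltnS.
Qed.

(** The oracle answers false outside the alternatives, so each query made by the formulas has to be
    shown well-formed. *)
Lemma prefers_codeE i (x y : activity I) k l :
  (x, k) \in alternatives n p -> (y, l) \in alternatives n p ->
  prefers_code I i (activity_code x) k (activity_code y) l = pref i (x, k) (y, l).
Proof.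
move=> xk yl; apply/existsP/idP => [[i' /existsP [x' /existsP [y']]]|xy].
  move=> /and3P [/eqP /val_inj ->].
  by move=> /eqP /activity_code_inj -> /and4P [/eqP /activity_code_inj ->].
by exists i; apply/existsP; exists x; apply/existsP; exists y; rewrite !eqxx xk yl.
Qed.

Lemma sprefers_codeE i (x y : activity I) k l :
  (x, k) \in alternatives n p -> (y, l) \in alternatives n p ->
  sprefers_code I i (activity_code x) k (activity_code y) l = sprefers i (x, k) (y, l).
Proof. by move=> xk yl; rewrite /sprefers_code !prefers_codeE. Qed.

(** A relation, because only the lowest n digits of [c] matter: many numbers code the same
    assignment. *)
Definition coded (c : nat) (pi : assignment I) : Prop :=
  forall i, act I c i = activity_code (pi i).

Lemma coded_code (pi : assignment I) : exists2 c, c < p.+1 ^ n & coded c pi.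
Proof.
pose f k : nat := if insub k is Some i then activity_code (pi i) else 0.
have [|c cn Hc] := @digit_exists n p.+1 f.
  by move=> k; rewrite /f; case: insub => // i; case: (pi i) => //= a; rewrite ltnS.
exists c => // i; by rewrite /act Hc // /f valK.
Qed.

Lemma coded_assignment c : exists pi, coded c pi.
Proof.
exists [ffun i : player I => if act I c i is a.+1 then insub a else None] => i.
have: act I c i < p.+1 by apply: ltn_pmod.
rewrite ffunE; case: act => //= a; rewrite ltnS => ap.
by rewrite insubT.
Qed.

(** * Correctness for one code and its assignment *)

Section Coded.
Variables (c : nat) (pi : assignment I).
Hypothesis cpi : coded c pi.

Lemma act_eqE i a : (act I c i == a.+1) = (pi i == Some a).
Proof. by rewrite cpi -(inj_eq (@activity_code_inj p)). Qed.

Lemma mem_membersE a i : (act I c i == a.+1) = (i \in members pi a).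
Proof. by rewrite inE act_eqE. Qed.

Lemma group_codeE i j : group_code I c i j = (j \in group pi i).
Proof.
rewrite /group_code /group cpi; case E : (pi i) => [a|] /=; last first.
  by rewrite orbF inE.
rewrite act_eqE inE; case: eqP => // /val_inj ->.
by rewrite E eqxx.
Qed.

Lemma mem_group i : i \in group pi i.
Proof. by rewrite -group_codeE /group_code eqxx. Qed.

Lemma mem_alternatives_outcome i : outcome pi i \in alternatives n p.
Proof.
have := mem_group i; rewrite /outcome /group; case E: (pi i) => [a|] /=; last first.
  by rewrite cards1 mem_alternatives_None.
by move=> /card_players ?; apply: mem_alternatives_Some.
Qed.

Lemma feasible_codeP : reflect (feasible pi) (feasible_code I c).
Proof.
apply: (iffP (all_iotaP _ _)) => H i; move: (H i);
  by rewrite (connected_codeE (S := group pi i)) // => j; rewrite group_codeE.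
Qed.

Lemma rational_codeP : reflect (individually_rational pi) (rational_code I c).
Proof.
have E i : prefers_code I i (act I c i) (popcount I (group_code I c i)) 0 1 =
    pref i (outcome pi i) (None, 1).
  rewrite cpi (popcountE (group_codeE i)) -(prefers_codeE _ _ mem_alternatives_None) //.
  exact: mem_alternatives_outcome.
by apply: (iffP (all_iotaP _ _)) => H i; move: (H i); rewrite E.
Qed.

Lemma sprefers_outcomeE i a k : 0 < k <= n ->
  sprefers_code I i a.+1 k (act I c i) (popcount I (group_code I c i)) =
  sprefers i (Some a, k) (outcome pi i).
Proof.
move=> kn; rewrite cpi (popcountE (group_codeE i)).
apply: (@sprefers_codeE i (Some a) (pi i)); first exact: mem_alternatives_Some.
exact: mem_alternatives_outcome.
Qed.

Lemma core_codeP (t : nat) S a : (forall i, bit t i = (i \in S)) ->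
  reflect [/\ S != set0, connected S & strongly_blocks pi S a] (core_code I c t a).
Proof.
move=> tS; rewrite /core_code (connected_codeE tS) (popcountE tS).
have spE i : i \in S ->
    sprefers_code I i a.+1 #|S| (act I c i) (popcount I (group_code I c i)) =
    sprefers i (Some a, #|S|) (outcome pi i).
  by move=> /card_players ?; apply: sprefers_outcomeE.
apply: (iffP and4P) => [[/has_iotaP [i ti] conS /all_iotaP sub /all_iotaP imp]|].
  split=> //; first by apply/set0Pn; exists i; rewrite -tS.
  split=> [|j jS].
    by apply/subsetP => j; rewrite -mem_membersE -tS; apply/implyP.
  by rewrite -spE //; apply: (implyP (imp j)); rewrite tS.
move=> [/set0Pn [i iS] conS [/subsetP sub imp]]; split=> //.
- by apply/has_iotaP; exists i; rewrite tS.
- by apply/all_iotaP => j; apply/implyP; rewrite mem_membersE tS; apply: sub.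
- by apply/all_iotaP => j; apply/implyP; rewrite tS => jS; rewrite spE ?imp.
Qed.

Lemma core_blockP :
  reflect (exists S a, [/\ S != set0, connected S & strongly_blocks pi S a])
    (core_block_code I c).
Proof.
apply: (iffP (has_iotaP _ _)) => [[t /has_iotaP [a tb]]|[S [a Sa]]].
  exists [set i : player I | bit t i], a; apply/(core_codeP (t := t)) => // i.
  by rewrite inE.
have [t tn tS] := bits_exist S; exists (Ordinal tn); apply/has_iotaP; exists a.
exact/(core_codeP _ tS).
Qed.

Lemma NS_codeP i a : reflect (NS_deviation pi i a) (NS_code I c i a).
Proof.
rewrite /NS_code act_eqE.
rewrite (connected_codeE (S := i |: members pi a)); last first.
  by move=> j; rewrite !inE act_eqE.
rewrite (popcountE (mem_membersE a)).
(* As [i] does not yet have activity [a], the enlarged group still has at most n players, which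
   makes the query well-formed. *)
have E : pi i <> Some a ->
    sprefers_code I i a.+1 #|members pi a|.+1
      (act I c i) (popcount I (group_code I c i)) =
    sprefers i (Some a, #|members pi a|.+1) (outcome pi i).
  move=> /eqP ia; apply: sprefers_outcomeE; apply: (@card_players_lt _ i).
  by rewrite inE.
apply: (iffP and3P) => -[ia con sp]; split=> //; first exact/eqP.
- by rewrite -E //; apply/eqP.
- exact/eqP.
- by rewrite E.
Qed.

Lemma NS_blockP : reflect (exists i a, NS_deviation pi i a) (NS_block_code I c).
Proof.
apply: (iffP (has_iotaP _ _)) => [[i /has_iotaP [a /NS_codeP]]|[i [a /NS_codeP d]]].
  by exists i, a.
by exists i; apply/has_iotaP; exists a.
Qed.

Lemma IS_codeP i a : reflect (IS_deviation pi i a) (IS_code I c i a).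
Proof.
rewrite /IS_code (popcountE (mem_membersE a)).
(* With [i] outside the group the enlarged size is at most n, and with [j] inside the size is at
   least 1: both queried pairs are alternatives. *)
have E j : NS_deviation pi i a -> j \in members pi a ->
    prefers_code I j a.+1 #|members pi a|.+1 a.+1 #|members pi a| =
    pref j (Some a, #|members pi a|.+1) (Some a, #|members pi a|).
  move=> [/eqP ia _ _] ja.
  have lt_n : #|members pi a| < n by apply: (@card_players_lt _ i); rewrite inE.
  apply: (@prefers_codeE j (Some a) (Some a)); apply: mem_alternatives_Some => //.
  exact: card_players ja.
apply: (iffP andP) => -[]; first move=> /NS_codeP d /all_iotaP H.
  by split=> // j ja; rewrite -E //; apply: (implyP (H j)); rewrite mem_membersE.
move=> d H; split; first exact/NS_codeP.
by apply/all_iotaP => j; apply/implyP; rewrite mem_membersE => ja; rewrite E ?H.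
Qed.

Lemma IS_blockP : reflect (exists i a, IS_deviation pi i a) (IS_block_code I c).
Proof.
apply: (iffP (has_iotaP _ _)) => [[i /has_iotaP [a /IS_codeP]]|[i [a /IS_codeP d]]].
  by exists i, a.
by exists i; apply/has_iotaP; exists a.
Qed.

End Coded.

Lemma stable_codeP (blocked : assignment I -> Prop) (block : nat -> bool) :
  (forall c pi, coded c pi -> reflect (blocked pi) (block c)) ->
  reflect (exists pi, [/\ feasible pi, individually_rational pi & ~ blocked pi])
    (stable_code I block).
Proof.
move=> HB; apply: (iffP (has_iotaP _ _)) => [[c /and3P [F R B]]|[pi [F R B]]].
  have [pi cpi] := coded_assignment c; exists pi; split.
  - exact/(feasible_codeP cpi).
  - exact/(rational_codeP cpi).
  - exact/(HB _ _ cpi).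
have [c cn cpi] := coded_code pi; exists (Ordinal cn); apply/and3P; split.
- exact/(feasible_codeP cpi).
- exact/(rational_codeP cpi).
- exact/(HB _ _ cpi).
Qed.

End Coding.

(** * Machines for the three problems *)

(** Serves as the exponent of the running time. A power of two as factor reduces the multiplication
    to [m] doublings; register 0 initially contains k, the length of the input. *)
Lemma computable_succ_exp2 m : computable (fun k => k.+1 * 2 ^ m).
Proof.
have dbl o s : exists t, exists s', exec o (iter m (Seq^~ (Add 0 0 0)) Skip) s t s' /\
    regs s' 0 = regs s 0 * 2 ^ m.
  elim: m => [|m [t [s' [X E]]]].
    by exists 1, s; rewrite muln1; split; first exact: ExecSkip.
  exists (t + 1), (set_reg s' 0 (regs s' 0 + regs s' 0)); split.
    by apply: ExecSeq X _; apply: ExecAdd.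
  by rewrite /= E addnn -mul2n expnS mulnCA.
exists (Seq (Const 1 1) (Seq (Add 0 0 1) (iter m (Seq^~ (Add 0 0 0)) Skip))) => k.
set s0 := init _; set s1 := set_reg s0 1 1.
set s2 := set_reg s1 0 (regs s1 0 + regs s1 1).
have [t [s' [X E]]] := dbl (fun=> false) s2.
exists (1 + (1 + t)), s'; split; last by rewrite E /= size_nseq addn1.
by apply: ExecSeq; [apply: ExecConst|apply: ExecSeq X; apply: ExecAdd].
Qed.

(* Register 5 is the address to start from, register 4 holds 1 and register 1
   receives the number of consecutive ones. *)
Definition count_ones : prog :=
  let next := Seq (Add 1 1 4) (Seq (Add 5 5 4) (Read 6 5)) in
  Seq (Read 6 5) (While 6 next).

(** Each one costs three instructions and a test; the other two steps are the first [Read] and the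
    failing test. Register 5 ends on the terminating zero. *)
Lemma count_ones_spec o m s :
  regs s 4 = 1 -> regs s 1 = 0 ->
  (forall i, i < m -> Defs.mem s (regs s 5 + i) = 1) ->
  Defs.mem s (regs s 5 + m) = 0 ->
  exists s', [/\ exec o count_ones s (m * 4 + 2) s', regs s' 1 = m,
    regs s' 5 = regs s 5 + m, forall j, j \notin [:: 1; 5; 6] -> regs s' j = regs s j &
    Defs.mem s' = Defs.mem s].
Proof.
pose next := Seq (Add 1 1 4) (Seq (Add 5 5 4) (Read 6 5)).
have loop : forall m s, regs s 4 = 1 -> regs s 6 = Defs.mem s (regs s 5) ->
    (forall i, i < m -> Defs.mem s (regs s 5 + i) = 1) ->
    Defs.mem s (regs s 5 + m) = 0 ->
    exists s', [/\ exec o (While 6 next) s (m * 4 + 1) s',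
      regs s' 1 = regs s 1 + m, regs s' 5 = regs s 5 + m,
      forall j, j \notin [:: 1; 5; 6] -> regs s' j = regs s j &
      Defs.mem s' = Defs.mem s].
  move=> {}m; elim: m => [|m IH] {}s s4 s6 ones zero.
    exists s; rewrite !addn0 in zero *; split=> //.
    by apply: ExecWhileFalse; rewrite s6.
  pose s1 := set_reg s 1 (regs s 1 + regs s 4).
  pose s2 := set_reg s1 5 (regs s1 5 + regs s1 4).
  pose s3 := set_reg s2 6 (Defs.mem s2 (regs s2 5)).
  have s35 : regs s3 5 = (regs s 5).+1 by rewrite /= s4 addn1.
  have [|||| s' [X R1 R5 P M]] := IH s3 => //.
  - by move=> i im; rewrite s35 addSnnS; apply: ones.
  - by rewrite s35 addSnnS.
  exists s'; split.
  - have -> : m.+1 * 4 + 1 = ((1 + (1 + 1)) + (m * 4 + 1)).+1 by lia.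
    apply: ExecWhileTrue X; first by rewrite s6 -[regs s 5]addn0 ones.
    apply: ExecSeq; first exact: ExecAdd.
    by apply: ExecSeq; [apply: ExecAdd|apply: ExecRead].
  - by rewrite R1 /= s4 -addnA add1n.
  - by rewrite R5 s35 addSnnS.
  - move=> j jn; rewrite P //=; move: jn; rewrite !inE.
    by case: eqP => // _; case: eqP => // _; case: eqP.
  - exact: M.
move=> s4 s1 ones zero; pose s0 := set_reg s 6 (Defs.mem s (regs s 5)).
have [|||| s' [X R1 R5 P M]] := loop m s0 => //.
exists s'; split=> //.
- have -> : m * 4 + 2 = 1 + (m * 4 + 1) by lia.
  by apply: ExecSeq X; apply: ExecRead.
- by rewrite R1 /= s1.
- move=> j jn; rewrite P //=; move: jn; rewrite !inE.
  by case: eqP => // _; case: eqP => // _; case: eqP.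
Qed.

(** Writing the rest of the word as a [drop] keeps its contents out of all arguments about the two
    unary headers. *)
Lemma encode_prefix I : encode I =
  nseq (nplayers I) true ++ false :: nseq (nactivities I) true ++ false ::
  drop (nplayers I + nactivities I + 2) (encode I).
Proof.
rewrite /encode; set n := nplayers I; set p := nactivities I.
move: (_ ++ flatten _) => s.
rewrite (_ : n + p + 2 = (p + 1).+1 + n) -?drop_drop; last lia.
rewrite drop_cat size_nseq ltnn subnn drop0 /= addnC -drop_drop.
by rewrite drop_cat size_nseq ltnn subnn drop0 /= drop0.
Qed.

Lemma size_encode I : nplayers I + nactivities I + 2 <= size (encode I).
Proof. by rewrite encode_prefix size_cat /= size_cat /= !size_nseq; lia. Qed.

Lemma nth_encode_players I i : i < nplayers I -> nth false (encode I) i.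
Proof. by move=> ni; rewrite encode_prefix nth_cat size_nseq ni nth_nseq ni. Qed.

Lemma nth_encode_sep I : nth false (encode I) (nplayers I) = false.
Proof. by rewrite encode_prefix nth_cat size_nseq ltnn subnn. Qed.

Lemma nth_encode_activities I i : i < nactivities I ->
  nth false (encode I) (nplayers I + 1 + i).
Proof.
move=> pi; rewrite encode_prefix nth_cat size_nseq ltnNge -addnA leq_addr /=.
rewrite addKn add1n /=.
by rewrite nth_cat size_nseq pi nth_nseq pi.
Qed.

Lemma nth_encode_sep2 I :
  nth false (encode I) (nplayers I + 1 + nactivities I) = false.
Proof.
rewrite encode_prefix nth_cat size_nseq ltnNge -addnA leq_addr /= addKn add1n /=.
by rewrite nth_cat size_nseq ltnn subnn.
Qed.

(* Puts n in register 2, p in register 1 and 0 in register 3. *)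
Definition parse : prog :=
  Seq (Const 4 1) (Seq count_ones (Seq (Const 3 0) (Seq (Add 2 1 3)
    (Seq (Const 1 0) (Seq (Add 5 5 4) count_ones))))).

Lemma parse_spec o I : exists s',
  [/\ exec o parse (init (encode I)) (4 * (nplayers I + nactivities I) + 9) s',
      holds (k := 0) [:: 2; 1] I s' & regs s' 3 = 0].
Proof.
set n := nplayers I; set p := nactivities I.
pose s1 := set_reg (init (encode I)) 4 1.
have [|||| s2 [X2 R1 R5 P M]] := @count_ones_spec o n s1 => //.
- by move=> i ni; rewrite /= add0n nth_encode_players.
- by rewrite /= add0n nth_encode_sep.
(* Adding register 3, just cleared, copies n to register 2; register 5 then moves past the separator
   to the unary p. *)
pose s3 := set_reg s2 3 0; pose s4 := set_reg s3 2 (regs s3 1 + regs s3 3).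
pose s5 := set_reg s4 1 0; pose s6 := set_reg s5 5 (regs s5 5 + regs s5 4).
have E5 : regs s6 5 = n + 1 by rewrite /= R5 P //= add0n.
have [|||| s7 [X7 R1' R5' P' M']] := @count_ones_spec o p s6 => //.
- by rewrite /= P.
- by move=> i pi; rewrite E5 /= M /= nth_encode_activities.
- by rewrite E5 /= M /= nth_encode_sep2.
exists s7; split.
- have -> : 4 * (n + p) + 9 =
      1 + ((n * 4 + 2) + (1 + (1 + (1 + (1 + (p * 4 + 2)))))) by lia.
  apply: ExecSeq; first exact: ExecConst.
  apply: ExecSeq X2 _; apply: ExecSeq; first exact: ExecConst.
  apply: ExecSeq; first exact: ExecAdd.
  apply: ExecSeq; first exact: ExecConst.
  by apply: ExecSeq X7; apply: ExecAdd.
- by split; rewrite ?M' /= ?M // R1' P' //= R1 addn0.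
- by rewrite P'.
Qed.

(** [N] stands for n+p+2, and [N ^ n.+1 + N] bounds the scale; it is at most N^(2(n+1)). The
    remaining summands cost at most a factor 16 N, hence N^5. The exponent 2(n+1)m + 5 is then
    raised to the computable form (n+1) 2^(2m+5). *)
Lemma parse_time_le N n m : 1 < N -> n.+1 < N ->
  4 * N + 10 + (N ^ n.+1 + N) ^ m <= N ^ (n.+1 * 2 ^ (2 * m + 5)).
Proof.
move=> N1 nN; set X := N ^ (2 * n.+1 * m).
have X0 : 0 < X by rewrite expn_gt0 ltnW.
have leX : (N ^ n.+1 + N) ^ m <= X.
  rewrite /X expnM; case: m X X0 => // m _ _; rewrite leq_exp2r // mul2n -addnn expnD.
  apply: (@leq_trans (N * N ^ n.+1)).
    rewrite -[N in N * _](subnK N1) mulnDl mul2n -addnn.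
    have: N <= N ^ n.+1 by rewrite -[X in X <= _]expn1 leq_exp2l.
    lia.
  by rewrite leq_mul2r -[X in X <= _]expn1 leq_exp2l ?orbT.
have h16 : 16 <= N ^ 4 by rewrite (@leq_exp2r 2 N 4).
apply: (@leq_trans (N ^ 5 * X)).
  rewrite (expnS N 4).
  have: N * 16 * X <= N * N ^ 4 * X by rewrite leq_mul2r leq_mul2l h16 !orbT.
  nia.
rewrite /X -expnD leq_exp2l //.
apply: (@leq_trans (n.+1 * (2 * m + 5))); first by nia.
by rewrite leq_mul2l /=; apply/ltnW/ltn_expl.
Qed.

Lemma XP_of_decides (Q : gGASP -> Prop) (P : gGASP -> bool) :
  decides (k := 0) P -> (forall I, reflect (Q I) (P I)) -> XP_in_players Q.
Proof.
(* Registers 2 and 1 hold n and p, and 7 lies above all registers used by [parse]. Register 3 keeps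
   its 0 below the stack, so adding it moves the answer to register 0. *)
move=> [_ /(_ [:: 2; 1] 7 isT) [c [T [[m HT] Hc]]]] PQ.
exists (Seq parse (Seq c (Add 0 7 3))), (fun k => k.+1 * 2 ^ (2 * m + 5)).
split; first exact: computable_succ_exp2.
move=> I; have [s1 [X1 H1 R3]] := parse_spec (compare_alternatives I) I.
have [t [s2 [X2 tT [R2] P2 M2]]] := Hc I s1 H1.
exists (4 * (nplayers I + nactivities I) + 9 + (t + 1)).
exists (set_reg s2 0 (regs s2 7 + regs s2 3)); split.
- by apply: ExecSeq X1 _; apply: ExecSeq X2 _; apply: ExecAdd.
- set N := nplayers I + nactivities I + 2.
  apply: (@leq_trans (N ^ ((nplayers I).+1 * 2 ^ (2 * m + 5)))); last first.
    by rewrite leq_exp2r ?size_encode // muln_gt0 /= expn_gt0.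
  apply: leq_trans (parse_time_le _ _ _); try lia.
  have {}tT : t <= (N ^ (nplayers I).+1 + N) ^ m.
    apply: leq_trans tT (leq_trans (HT I) _).
    case: (m) => // m'; rewrite leq_exp2r // /scale /scale0 /= -/N leq_add2l; lia.
  lia.
- rewrite /= R2 P2 // R3 addn0; case: PQ => q; by [left|right].
Qed.

Theorem mainTheorem17 :
  [/\ XP_in_players (fun I : gGASP => exists pi : assignment I, core_stable pi),
      XP_in_players (fun I : gGASP => exists pi : assignment I, Nash_stable pi) &
      XP_in_players
        (fun I : gGASP => exists pi : assignment I, individually_stable pi)].
Proof.
have L := computes_last 0; split.
- apply: (XP_of_decides (decides_stable (decides_core_block L))) => I.
  by apply: stable_codeP => c pi; apply: core_blockP.
- apply: (XP_of_decides (decides_stable (decides_NS_block L))) => I.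
  by apply: stable_codeP => c pi; apply: NS_blockP.
- apply: (XP_of_decides (decides_stable (decides_IS_block L))) => I.
  by apply: stable_codeP => c pi; apply: IS_blockP.
Qed.
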